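(* Let $n,\ell,h\in\mathbb N$, let $W\in\mathcal M_{(n+1)\times(n+1)}(\mathbb R)$ be symmetric positive definite, and let $\mathcal E_W^n=\{\mathrm x\in\mathbb R^{n+1}\mid\mathrm x^\top W\mathrm x=1\}$. For each $1\le\eta\le h$ let $P_\eta:\mathbb R_0^+\to\mathcal M_{(n+1)\times(n+1)}(\mathbb R)$ be bounded, i.e. $\sup_{t\in\mathbb R_0^+}\|P_\eta(t)\|<\infty$, and uniformly continuous on $\mathbb R_0^+$. Consider on $(\mathcal E_W^n)^\ell$ the system $$\dot{\mathrm y}_i=\left(\mathbb I_{n+1}-\mathrm y_i\mathrm y_i^\top W\right)\left(\sum_{\eta=1}^h\sum_{j=1}^\ell\alpha_{ij}^\eta(t,\mathbf y)\,\mathrm y_j\right),\qquad 1\le i\le\ell,$$ where $\mathbf y=(\mathrm y_1,\dots,\mathrm y_\ell)$ and $$\alpha_{ij}^\eta(t,\mathbf y)=\frac{\exp(\mathrm y_i^\top P_\eta(t)\mathrm y_j)}{\sqrt{n+1}\sum_{k=1}^\ell\exp(\mathrm y_i^\top P_\eta(t)\mathrm y_k)}.$$ Let $v\in\mathcal E_W^n$ and let $\mathcal H^+(v)=\{\mathrm y\in\mathcal E_W^n\mid v^\top\mathrm y>0\}$. Then the consensus set $$\mathcal C_\ell^+(v)=\{(\mathrm y,\dots,\mathrm y)\in(\mathcal E_W^n)^\ell\mid\mathrm y\in\mathcal H^+(v)\}$$ is attractive for this system with domain of attraction $\mathcal H^+(v)^\ell$; that is, every solution $\mathbf y:\mathbb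 R_0^+\to(\mathcal E_W^n)^\ell$ with $\mathbf y(0)\in\mathcal H^+(v)^\ell$ converges to the set $\mathcal C_\ell^+(v)$ as $t\to\infty$.
   Context: $\mathbb N=\{1,2,\dots\}$, $\mathbb R_0^+=[0,\infty)$, and $\|\cdot\|$ is the Frobenius norm. Convergence of $\mathbf y(t)$ to a set means that the Euclidean distance from $\mathbf y(t)$ to the set tends to $0$. The right-hand side is tangent to $(\mathcal E_W^n)^\ell$. *)

(* Defs.v *)
From HB Require Import structures.
From mathcomp Require Import all_boot all_order all_algebra.
From mathcomp Require Import all_classical all_reals all_analysis.

Set Implicit Arguments.
Unset Strict Implicit.
Unset Printing Implicit Defensive.

Import Order.TTheory GRing.Theory Num.Theory.
Import numFieldNormedType.Exports.

Local Open Scope classical_set_scope.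
Local Open Scope ring_scope.

(* The library's norm on matrices is the sup norm, hence the next definition. *)
Definition frobenius (R : realType) (m n : nat) (A : 'M[R]_(m, n)) : R :=
  Num.sqrt (\sum_i \sum_j A i j ^+ 2).

Definition positive_definite (R : realType) (n : nat) (W : 'M[R]_n) : Prop :=
  forall x : 'cV[R]_n, x != 0 -> 0 < (x^T *m W *m x) 0 0.

(* Elements of (R^(n+1))^l are functions from 'I_l to column vectors. *)
Definition tokens (R : realType) (n l : nat) : Type := 'I_l -> 'cV[R]_(n.+1).

Definition euclidean_dist (R : realType) (n l : nat) (y z : tokens R n l) : R :=
  Num.sqrt (\sum_i frobenius (y i - z i) ^+ 2).

Definition dist_to_set (R : realType) (n l : nat)
    (y : tokens R n l) (C : set (tokens R n l)) : R :=
  inf [set euclidean_dist y z | z in C].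

Definition ellipsoid (R : realType) (n : nat) (W : 'M[R]_(n.+1)) :
    set 'cV[R]_(n.+1) :=
  [set x | (x^T *m W *m x) 0 0 = 1].

Definition hemisphere (R : realType) (n : nat) (W : 'M[R]_(n.+1))
    (v : 'cV[R]_(n.+1)) : set 'cV[R]_(n.+1) :=
  [set y | ellipsoid W y /\ 0 < (v^T *m y) 0 0].

Definition consensus (R : realType) (n l : nat) (W : 'M[R]_(n.+1))
    (v : 'cV[R]_(n.+1)) : set (tokens R n l) :=
  [set (fun=> y) | y in hemisphere W v].

Definition attention (R : realType) (n l : nat) (Pt : 'M[R]_(n.+1))
    (y : tokens R n l) (i j : 'I_l) : R :=
  expR (((y i)^T *m Pt *m y j) 0 0) /
  (Num.sqrt (n.+1)%:R * \sum_k expR (((y i)^T *m Pt *m y k) 0 0)).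

Definition attention_field (R : realType) (n l h : nat) (W : 'M[R]_(n.+1))
    (P : 'I_h -> R -> 'M[R]_(n.+1)) (t : R) (y : tokens R n l) (i : 'I_l) :
    'cV[R]_(n.+1) :=
  (1%:M - y i *m (y i)^T *m W) *m
  (\sum_(eta < h) \sum_(j < l) attention (P eta t) y i j *: y j).

(* Curves on [0, +oo[ are functions on R whose values at negative times are
   irrelevant; at time 0 the derivative is the right derivative. *)
Definition attention_solution (R : realType) (n l h : nat) (W : 'M[R]_(n.+1))
    (P : 'I_h -> R -> 'M[R]_(n.+1)) (y : R -> tokens R n l) : Prop :=
  [/\ forall (t : R) (i : 'I_l), 0 <= t -> ellipsoid W (y t i),
      forall (t : R) (i : 'I_l), 0 < t ->
        is_derive t (1 : R) (fun s : R => y s i) (attention_field W P t (y t) i)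
    & forall i : 'I_l,
        s^-1 *: (y s i - y 0 i) @[s --> (0 : R)^'+] -->
          attention_field W P 0 (y 0) i].

(* Main.v *)
(* In the central projection [z_i = y_i / (v^T y_i)] the tangential projection
   term cancels and the system becomes the linear consensus dynamics
   [z_i' = \sum_j c_ij * (v^T y_j / v^T y_i) * (z_j - z_i)], where [c_ij > 0]
   is the total attention weight.  The minimum over [i] of [v^T y_i] never
   decreases, since [<y_i, y_j>_W <= 1]; so the weights are bounded below by a
   positive constant, and the spread of every linear form of the [z_i] decays
   exponentially.  Finally [|y_i - y_j|_W] is controlled by [|z_i - z_j|_W]. *)

Require Import Defs.
From HB Require Import structures.
From mathcomp Require Import all_boot all_order all_algebra.
From mathcomp Require Import all_classical all_reals all_analysis.
From mathcomp Require Import ring lra.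
Import Order.TTheory GRing.Theory Num.Theory.
Import numFieldNormedType.Exports.
Local Open Scope classical_set_scope.
Local Open Scope ring_scope.

(** * Comparison principles for finite families of real functions *)

Lemma is_derive1_cvg {R : realType} {V : normedModType R} (f : R -> V)
    (t : R) (df : V) :
  is_derive t (1 : R) f df <->
  h^-1 *: (f (h + t) - f t) @[h --> (0 : R)^'] --> df.
Proof.
have fE : (fun h : R => h^-1 *: (f (h + t) - f t)) =
          (fun h : R => h^-1 *: ((f \o shift t) (h *: (1 : R)) - f t)).
  by apply/funext => h /=; rewrite /GRing.scale/= mulr1.
rewrite fE; split=> [[fd <-]|fl]; first exact: fd.
by split; [apply/cvg_ex; exists df | exact/cvg_lim].
Qed.

Lemma is_derive1_continuous {R : realType} (f : R -> R) (t df : R) :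
  is_derive t (1 : R) f df -> f s @[s --> t] --> f t.
Proof.
by move=> [fd _]; exact/differentiable_continuous/derivable1_diffP.
Qed.

Section comparison.
Context {R : realType} {I : finType}.
Implicit Types (F G dF dG : I -> R -> R).

(** At the first time [T] at which some [G p] reaches 0, that function was negative just before, so
    its left difference quotients are nonnegative; this contradicts the strict sign of [dG p T]. *)
Lemma first_crossing G dG :
  (forall p, G p s @[s --> 0^'+] --> G p 0) ->
  (forall p (t : R), 0 < t -> is_derive t (1 : R) (G p) (dG p t)) ->
  (forall p, G p 0 < 0) ->
  (forall p t, 0 < t -> (forall q, G q t <= 0) -> G p t = 0 -> dG p t < 0) ->
  forall p t, 0 <= t -> G p t < 0.
Proof.
move=> G0 Gd Gneg Gcross p0 t0 t0_ge0; rewrite ltNge; apply/negP => Gp0.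
pose S := [set t : R | 0 <= t /\ exists p, 0 <= G p t].
have St0 : S t0 by split=> //; exists p0.
have S0 : S !=set0 by exists t0.
have lbS : has_lbound S by exists 0 => t [].
pose T := inf S.
have below s p : 0 <= s -> s < T -> G p s < 0.
  move=> s_ge0 sT; rewrite ltNge; apply/negP => Gs.
  have : T <= s by apply: ge_inf => //; split=> //; exists p.
  by rewrite leNgt sT.
(* Right continuity at 0 keeps the whole finite family negative on some []0, d[], and time 0 itself
   is excluded by [Gneg]. *)
have Tgt0 : 0 < T.
  have : \forall s \near (0 : R)^'+, forall p, G p s < 0.
    by apply: filter_forall => p; exact: (cvgr_lt _ (G0 p)).
  move=> [/= d d0 dG0]; apply: lt_le_trans d0 _; apply: lb_le_inf => // s.
  move=> [s0 [p Gps]]; rewrite leNgt; apply/negP => sd.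
  have s_gt0 : 0 < s.
    rewrite lt_neqAle s0 andbT; apply/eqP => s00.
    by have := Gneg p; rewrite ltNge [in G p 0]s00 Gps.
  have := dG0 s; rewrite /= sub0r normrN gtr0_norm// => /(_ sd s_gt0 p).
  by rewrite ltNge Gps.
have Gcont p : G p s @[s --> T] --> G p T.
  exact: is_derive1_continuous (Gd p T Tgt0).
have near_left : \forall s \near T^'-, forall p, G p s < 0.
  near=> s => p; apply: below; last by near: s; exact: nbhs_left_lt.
  by apply: ltW; near: s; exact: nbhs_left_gt.
have GT_le0 q : G q T <= 0.
  have GT := cvg_at_left_filter (Gcont q).
  rewrite -(cvg_lim _ GT)//; apply: limr_le; first exact: cvgP GT.
  by apply: filterS near_left => s /(_ q)/ltW.
(* Otherwise, by continuity, the family would stay negative up to [T + d], beyond the infimum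
   [T]. *)
have [p GpT] : exists p, 0 <= G p T.
  apply: contrapT => /forallNP GT.
  have : \forall s \near nbhs T, forall p, G p s < 0.
    apply: filter_forall => p; apply: (cvgr_lt _ (Gcont p)).
    by rewrite ltNge; exact/negP/GT.
  move=> [/= d d0 dGT].
  suff : T + d <= T by rewrite gerDl leNgt d0.
  apply: lb_le_inf => // s [s0 [p Gps]]; rewrite leNgt; apply/negP => sTd.
  have [sT|Ts] := ltP s T; first by have := below s p s0 sT; rewrite ltNge Gps.
  have := dGT s; rewrite /= ler0_norm ?subr_le0// opprB ltrBlDl sTd.
  by move=> /(_ isT p); rewrite ltNge Gps.
have GpT0 : G p T = 0 by apply/eqP; rewrite eq_le GT_le0.
have := Gcross p T Tgt0 GT_le0 GpT0; rewrite ltNge => /negP; apply.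
have /is_derive1_cvg /cvg_dnbhs_at_left GD := Gd p T Tgt0.
rewrite -(cvg_lim _ GD)//; apply: limr_ge; first exact: cvgP GD.
near=> s.
have s_lt0 : s < 0 by near: s; exact: nbhs_left_lt.
have sT : - T < s by near: s; apply: nbhs_left_gt; rewrite oppr_lt0.
rewrite GpT0 subr0 /GRing.scale/=.
rewrite mulr_le0 ?invr_le0 ?(ltW s_lt0)// ltW// below//; lra.
Unshelve. all: by end_near. Qed.

(* The threshold [K] allows the sign condition to be required only where
   [F p t < K]. *)
Lemma max_nonincreasing F dF (M K : R) : M < K ->
  (forall p, F p s @[s --> 0^'+] --> F p 0) ->
  (forall p (t : R), 0 < t -> is_derive t (1 : R) (F p) (dF p t)) ->
  (forall p, F p 0 <= M) ->
  (forall p t, 0 < t -> F p t < K -> (forall q, F q t <= F p t) ->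
     dF p t <= 0) ->
  forall p t, 0 <= t -> F p t <= M.
Proof.
move=> MK F0 Fd FM Fmax p t t0; apply/ler_addgt0Pr => e e0.
(* This choice keeps the barrier [b] below both [M + e] and [K]. *)
pose d := Num.min e (K - M) / 2.
have d0 : 0 < d by rewrite divr_gt0// lt_min e0 subr_gt0.
have [de dK] : 2 * d <= e /\ 2 * d <= K - M.
  by rewrite /d mulrCA divff// mulr1 !ge_min !lexx orbT.
(* [b] is a strictly increasing barrier with values in [M + d, M + 2 d[ *)
pose b (s : R) := M + 2 * d - d * expR (- s).
pose db (s : R) := d * expR (- s).
have bd (s : R) : is_derive s (1 : R) b (db s).
  have -> : b = cst (M + 2 * d) - d *: (expR \o -%R) by apply/funext.
  have ed : is_derive s (1 : R) (expR \o -%R) (expR (- s) * -1).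
    exact: is_derive1_comp.
  apply: is_derive_eq.
  by rewrite /db /GRing.scale/=; ring.
pose G p s := F p s - b s.
suff : G p t < 0.
  rewrite subr_lt0 => /ltW/le_trans; apply; rewrite /b.
  have := expR_gt0 (- t); nra.
apply: (@first_crossing G (fun p s => dF p s - db s)) => //.
- move=> q; apply: cvgB => //.
  by apply: cvg_at_right_filter; exact: is_derive1_continuous.
- by move=> q s s0; apply: is_deriveB; exact: Fd.
- move=> q; rewrite /G /b oppr0 expR0; have := FM q; lra.
(* On contact with the barrier, [F q s = b s < K] and all other values are at most [b s], so [q]
   attains the maximum and [Fmax] applies; [db s > 0] makes the inequality strict. *)
- move=> q s s0 Gle0 Gq0.
  have dbs : 0 < db s by rewrite mulr_gt0// expR_gt0.
  suff : dF q s <= 0 by lra.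
  move: Gle0 Gq0; rewrite /G => Gle0 Gq0.
  apply: Fmax => //.
    by move: Gq0 dbs; rewrite /b /db; lra.
  by move=> q'; have := Gle0 q'; lra.
Qed.

End comparison.

(** * Exponential contraction of linear consensus dynamics *)

Lemma is_derive_expR_mul {R : realType} (a t : R) :
  is_derive t (1 : R) (fun s : R => expR (s * a)) (expR (t * a) * a).
Proof.
have -> : (fun s : R => expR (s * a)) = expR \o (a *: (@id R)).
  by apply/funext => s /=; rewrite mulrC.
apply: is_derive_eq.
by rewrite [t * a]mulrC /GRing.scale/= mulr1.
Qed.

(** The maximum over all pairs of [expR (t * a) * (g i t - g j t)] does not increase: at a maximal
    pair, [i] is a largest and [j] a smallest component, and their difference shrinks at rate at
    least [a]. Pairs are used as indices so that the spread becomes the maximum of a finite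
    family. *)
Lemma linear_consensus {R : realType} {I : finType} (g : I -> R -> R)
    (w : I -> I -> R -> R) (a : R) :
  0 < a ->
  (forall i j t, 0 < t -> a <= w i j t) ->
  (forall i, g i s @[s --> 0^'+] --> g i 0) ->
  (forall i (t : R), 0 < t ->
     is_derive t (1 : R) (g i) (\sum_j w i j t * (g j t - g i t))) ->
  forall i j, g i t - g j t @[t --> +oo] --> 0.
Proof.
move=> a0 aw g0 gd.
pose dg i t := \sum_j w i j t * (g j t - g i t).
pose F (p : I * I) (t : R) := expR (t * a) * (g p.1 t - g p.2 t).
pose dF (p : I * I) (t : R) :=
  expR (t * a) * (a * (g p.1 t - g p.2 t) + (dg p.1 t - dg p.2 t)).
pose M := \sum_p `|F p 0|.
have w_ge0 i j t : 0 < t -> 0 <= w i j t.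
  by move=> t0; rewrite (le_trans (ltW a0))// aw.
have FM p t : 0 <= t -> F p t <= M.
  (* Any threshold above [M] would do, because the sign condition holds at every maximal pair. *)
  move: p t; apply: (@max_nonincreasing _ _ F dF M (M + 1)).
  - by rewrite ltrDl.
  - move=> [i j]; rewrite /F /=; apply: cvgM; last exact: cvgB.
    apply: cvg_at_right_filter.
    exact: is_derive1_continuous (is_derive_expR_mul a 0).
  - move=> [i j] t t0; rewrite /dF /=.
    have ed := is_derive_expR_mul a t.
    have gi := gd i t t0.
    have gj := gd j t t0.
    have -> : F (i, j) = (fun s : R => expR (s * a)) * (g i - g j).
      exact/funext.
    apply: is_derive_eq.
    rewrite /GRing.scale/= -/(dg i t) -/(dg j t) !fctE; ring.
  - by move=> p; rewrite (le_trans (ler_norm _))// /M (bigD1 p)//= lerDl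
      sumr_ge0.
  - move=> [i j] t t0 _ Fmax.
    have E0 : 0 < expR (t * a) by exact: expR_gt0.
    have gi k : g k t <= g i t.
      by have := Fmax (k, j); rewrite /F ler_pM2l//= lerD2r.
    have gj k : g j t <= g k t.
      by have := Fmax (i, k); rewrite /F ler_pM2l//= lerD2l lerN2.
    (* All summands are nonpositive, so the one of index [j] alone bounds the sum. *)
    have dgi : dg i t <= a * (g j t - g i t).
      rewrite /dg (bigD1 j)//= -[leRHS]addr0 lerD//.
        by rewrite ler_wnM2r ?aw// subr_le0.
      by rewrite sumr_le0// => k _; rewrite mulr_ge0_le0 ?w_ge0// subr_le0.
    have dgj : 0 <= dg j t.
      by rewrite sumr_ge0// => k _; rewrite mulr_ge0 ?w_ge0// subr_ge0.
    by rewrite /dF /= mulr_ge0_le0 ?(ltW E0)//; lra.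
move=> i j.
have bound k m t : 0 <= t -> g k t - g m t <= M * expR (- (t * a)).
  by move=> t0; rewrite expRN ler_pdivlMr ?expR_gt0// mulrC; exact: (FM (k, m)).
have lim0 : M * expR (- (t * a)) @[t --> +oo] --> 0.
  rewrite -(mulr0 M); apply: cvgMl_tmp.
  apply: (@cvg_comp _ _ _ (fun t : R => t * a) (fun x : R => expR (- x)) _
    (pinfty_nbhs R)); last exact: cvgr_expR.
  by apply: gt0_cvgMly => //; exact: cvg_id.
apply: (squeeze_cvgr _ _ lim0); last by rewrite -oppr0; exact: cvgN lim0.
near=> t.
have t0 : 0 <= t by near: t; apply: nbhs_pinfty_ge; exact: num_real.
rewrite bound// andbT lerNl opprB; exact: bound.
Unshelve. all: by end_near. Qed.

(** * The inner product defined by [W] *)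

Definition wdot {R : realType} {n : nat} (W : 'M[R]_(n.+1))
    (x y : 'cV[R]_(n.+1)) : R := (x^T *m W *m y) 0 0.

Section weighted_inner_product.
Context {R : realType} {n : nat} {W : 'M[R]_(n.+1)}.
Hypothesis Wsym : W^T = W.
Hypothesis Wpos : positive_definite W.
Implicit Types (x y : 'cV[R]_(n.+1)) (L : 'rV[R]_(n.+1)).
Local Notation wdot := (wdot W).

Lemma wdotC x y : wdot x y = wdot y x.
Proof.
have -> : wdot x y = ((x^T *m W *m y)^T) 0 0 by rewrite mxE.
by rewrite !trmx_mul trmxK Wsym mulmxA.
Qed.

Lemma wdot_ge0 x : 0 <= wdot x x.
Proof.
have [->|x0] := eqVneq x 0; first by rewrite /wdot mulmx0 mxE.
exact/ltW/Wpos.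
Qed.

Lemma wdot_comb (a b : R) x y :
  wdot (a *: x + b *: y) (a *: x + b *: y) =
  a ^+ 2 * wdot x x + 2 * a * b * wdot x y + b ^+ 2 * wdot y y.
Proof.
have expand z : wdot (a *: x + b *: y) z = a * wdot x z + b * wdot y z.
  by rewrite /wdot linearD !linearZ /= !mulmxDl -!scalemxAl !mxE.
by rewrite expand !(wdotC _ (a *: x + b *: y)) !expand (wdotC y x); ring.
Qed.

Lemma wdot_CauchySchwarz x y : wdot x y ^+ 2 <= wdot x x * wdot y y.
Proof.
have [->|x0] := eqVneq x 0.
  by rewrite /wdot trmx0 !mul0mx mxE expr0n mul0r.
have qx : 0 < wdot x x by exact: Wpos.
(* The square of this vector is [wdot x x * (wdot x x * wdot y y - wdot x y ^+ 2)]. *)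
have := wdot_ge0 (- wdot x y *: x + wdot x x *: y).
rewrite wdot_comb => H.
rewrite -subr_ge0 -(pmulr_rge0 _ qx); apply: le_trans H _.
by rewrite le_eqVlt; apply/orP; left; apply/eqP; ring.
Qed.

(** Riesz representation: a positive definite [W] has trivial kernel, hence is invertible, and [w]
    solves [W w = L^T]. It opens every linear form to the Cauchy-Schwarz inequality. *)
Lemma row_form_representer L :
  exists w, forall x, (L *m x) 0 0 = wdot w x.
Proof.
have Wu : W \in unitmx.
  rewrite unitmxE unitfE; apply/negP => /det0P[r r0 rW].
  have := Wpos r^T; rewrite trmx_eq0 trmxK rW mul0mx mxE ltxx.
  by move=> /(_ r0).
exists (invmx W *m L^T) => x.
by rewrite /wdot trmx_mul trmxK trmx_inv Wsym mulmxKV.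
Qed.

Lemma row_form_bounded L :
  exists C : R, 0 < C /\ forall x, (L *m x) 0 0 ^+ 2 <= C * wdot x x.
Proof.
have [w wE] := row_form_representer L.
(* The summand 1 keeps the constant positive when [L = 0]. *)
exists (1 + wdot w w); split=> [|x]; first by have := wdot_ge0 w; lra.
rewrite wE (le_trans (wdot_CauchySchwarz _ _))// mulrDl lerDr mul1r.
exact: wdot_ge0.
Qed.

Lemma coord_ellipsoid_bounded :
  exists2 X : R, 0 < X & forall x k, ellipsoid W x -> `|x k 0| <= X.
Proof.
pose e k : 'rV[R]_(n.+1) := delta_mx 0 k.
have coordE k x : x k 0 = (e k *m x) 0 0 by rewrite -rowE mxE.
have [C CP] := choice (fun k => row_form_bounded (e k)).
have C0 k : 0 < C k by have [] := CP k.
exists (\sum_k (C k + 1)).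
  rewrite big_ord_recl ltr_pwDl ?sumr_ge0//; first by have := C0 ord0; lra.
  by move=> k _; have := C0 (lift ord0 k); lra.
move=> x k xE.
(* From [u ^+ 2 <= C] follows [u <= C + 1], which avoids a square root. *)
have le1 : `|x k 0| <= C k + 1.
  have := (CP k).2 x; rewrite -coordE /wdot xE mulr1 -real_normK ?num_real//.
  have := normr_ge0 (x k 0); have := C0 k; nra.
rewrite (le_trans le1)// (bigD1 k)//= lerDl sumr_ge0// => k' _.
by have := C0 k'; lra.
Qed.

Lemma wdot_ellipsoid_le1 x y : ellipsoid W x -> ellipsoid W y -> wdot x y <= 1.
Proof.
move=> xE yE; have := wdot_CauchySchwarz x y.
by rewrite /wdot xE yE mulr1; set b := _ 0 0; nra.
Qed.

(* AM-GM: [a / b + b / a >= 2]. *)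
Lemma wdot_sub_central_projection (a b : R) x y :
  0 < a -> 0 < b -> ellipsoid W x -> ellipsoid W y ->
  wdot (x - y) (x - y) <=
  a * b * wdot (a^-1 *: x - b^-1 *: y) (a^-1 *: x - b^-1 *: y).
Proof.
move=> a0 b0 xE yE.
rewrite -(scale1r x) -(scale1r y) !scalerA !mulr1 -!scaleNr !wdot_comb.
have [-> ->] : wdot x x = 1 /\ wdot y y = 1 by [].
have an0 : a != 0 by rewrite gt_eqF.
have bn0 : b != 0 by rewrite gt_eqF.
rewrite -subr_ge0; set c := wdot x y.
have -> : a * b * (a^-1 ^+ 2 * 1 + 2 * a^-1 * - b^-1 * c + (- b^-1) ^+ 2 * 1) -
   (1 ^+ 2 * 1 + 2 * 1 * -1 * c + (-1) ^+ 2 * 1) = (a - b) ^+ 2 / (a * b).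
  by field; rewrite ?an0 ?bn0.
by rewrite divr_ge0 ?sqr_ge0// mulr_ge0// ltW.
Qed.

End weighted_inner_product.

(** * Limits and derivatives of linear forms along curves *)

Lemma cvgr_sum {R : realType} {T : Type} {F : set_system T} {FF : Filter F}
    {I : finType} (f : I -> T -> R) (l : I -> R) :
  (forall i, f i x @[x --> F] --> l i) ->
  \sum_i f i x @[x --> F] --> \sum_i l i.
Proof. by move=> fl; apply: cvg_big => //; exact: add_continuous. Qed.

Lemma cvgr_sum0 {R : realType} {T : Type} {F : set_system T} {FF : Filter F}
    {I : finType} (f : I -> T -> R) :
  (forall i, f i x @[x --> F] --> 0) -> \sum_i f i x @[x --> F] --> 0.
Proof.
move=> f0; suff : \sum_i f i x @[x --> F] --> \sum_(i : I) (0 : R).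
  by rewrite big1.
exact: cvgr_sum.
Qed.

Lemma cvg_row_form {R : realType} {n : nat} {T : Type} {F : set_system T}
    {FF : Filter F} (L : 'rV[R]_(n.+1)) (f : T -> 'cV[R]_(n.+1))
    (l : 'cV[R]_(n.+1)) :
  f x @[x --> F] --> l -> (L *m f x) 0 0 @[x --> F] --> (L *m l) 0 0.
Proof.
move=> fl; rewrite mxE; under eq_fun do rewrite mxE.
apply: cvgr_sum => k; apply: cvgMl_tmp.
exact: (cvg_comp _ _ fl (@coord_continuous _ _ _ k 0 l)).
Qed.

Lemma is_derive_row_form {R : realType} {n : nat} (L : 'rV[R]_(n.+1))
    (f : R -> 'cV[R]_(n.+1)) (t : R) (df : 'cV[R]_(n.+1)) :
  is_derive t (1 : R) f df ->
  is_derive t (1 : R) (fun s => (L *m f s) 0 0) ((L *m df) 0 0).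
Proof.
move=> /is_derive1_cvg/(cvg_row_form L) fL; apply/is_derive1_cvg.
apply: cvg_trans fL; apply: near_eq_cvg; near=> s.
by rewrite -scalemxAr mulmxBr !mxE.
Unshelve. all: by end_near. Qed.

(** * Estimates for the attention weights, and linear forms of the vector field *)

Lemma frobenius_sqr {R : realType} {m n : nat} (A : 'M[R]_(m, n)) :
  frobenius A ^+ 2 = \sum_i \sum_j A i j ^+ 2.
Proof.
rewrite sqr_sqrtr// sumr_ge0// => i _; rewrite sumr_ge0// => j _.
exact: sqr_ge0.
Qed.

Lemma abs_coord_le_frobenius {R : realType} {m n : nat} (A : 'M[R]_(m, n)) i j :
  `|A i j| <= frobenius A.
Proof.
rewrite -sqrtr_sqr ler_wsqrtr// (bigD1 i)//= (bigD1 j)//= -addrA lerDl.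
by rewrite addr_ge0// ?sumr_ge0// => *; rewrite ?sumr_ge0// => *;
  rewrite sqr_ge0.
Qed.

Lemma bilinear_form_bound {R : realType} {n : nat} (A : 'M[R]_n)
    (x y : 'cV[R]_n) (X B : R) :
  0 <= X -> (forall k, `|x k 0| <= X) -> (forall k, `|y k 0| <= X) ->
  frobenius A <= B ->
  `|(x^T *m A *m y) 0 0| <= \sum_(j < n) \sum_(k < n) X * B * X.
Proof.
move=> X0 xX yX AB; rewrite mxE (le_trans (ler_norm_sum _ _ _))//.
rewrite ler_sum// => j _.
rewrite normrM mxE -mulr_suml ler_pM//.
rewrite (le_trans (ler_norm_sum _ _ _))// ler_sum// => k _.
by rewrite mxE normrM ler_pM// (le_trans (abs_coord_le_frobenius _ _ _)).
Qed.

Lemma attention_lower_bound {R : realType} {n l : nat} (Q : 'M[R]_(n.+1))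
    (y : tokens R n l) (B : R) i j :
  (forall i j, `|((y i)^T *m Q *m y j) 0 0| <= B) ->
  expR (- B) / (Num.sqrt (n.+1)%:R * (l%:R * expR B)) <= attention Q y i j.
Proof.
move=> yB.
have l0 : (0 < l)%N by apply: leq_ltn_trans (ltn_ord i).
have sq : 0 < Num.sqrt (n.+1)%:R :> R by rewrite sqrtr_gt0.
have sum_gt0 : 0 < \sum_k expR (((y i)^T *m Q *m y k) 0 0).
  by rewrite (bigD1 i)//= ltr_pwDl ?expR_gt0// sumr_ge0.
have yB' k k' : - B <= ((y k)^T *m Q *m y k') 0 0 <= B by rewrite -ler_norml.
rewrite /attention; apply: ler_pM; rewrite ?expR_ge0//.
- by rewrite ler_expR; case/andP: (yB' i j).
- rewrite lef_pV2 ?posrE ?mulr_gt0 ?expR_gt0 ?ltr0n//.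
  rewrite ler_pM2l// mulr_natl -[in leRHS](card_ord l) -sumr_const.
  rewrite ler_sum// => k _.
  by rewrite ler_expR; case/andP: (yB' i k).
Qed.

(** The factor of [(L *m y i) 0 0] in the subtracted term does not depend on [L]. This is why that
    term disappears from the derivative of a quotient of two forms. *)
Lemma mulmx_attention_field {R : realType} {n l h : nat} (W : 'M[R]_(n.+1))
    (P : 'I_h -> R -> 'M[R]_(n.+1)) (t : R) (y : tokens R n l) (i : 'I_l)
    (L : 'rV[R]_(n.+1)) :
  let c j := \sum_eta attention (P eta t) y i j in
  (L *m attention_field W P t y i) 0 0 =
  \sum_j c j * (L *m y j) 0 0 -
  (L *m y i) 0 0 * \sum_j c j * wdot W (y i) (y j).
Proof.
move=> c; rewrite /attention_field exchange_big /=.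
under eq_bigr do rewrite -scaler_suml.
set s := \sum_j _ *: y j.
(* Used twice: for [L] and for the row [(y i)^T *m W]. *)
have formE (K : 'rV[R]_(n.+1)) : K *m s = (\sum_j c j * (K *m y j) 0 0)%:M.
  rewrite mulmx_sumr raddf_sum; apply: eq_bigr => j _ /=.
  by rewrite -scalemxAr {1}[K *m y j]mx11_scalar scale_scalar_mx.
have -> : L *m ((1%:M - y i *m (y i)^T *m W) *m s) =
    L *m s - (L *m y i) *m ((y i)^T *m W *m s).
  by rewrite mulmxBl mul1mx mulmxBr !mulmxA.
rewrite !formE mul_mx_scalar [LHS]mxE [X in _ + X]mxE [X in X + _]mxE mulr1n.
by rewrite [X in - X]mxE mulrC.
Qed.

(** * Solutions of the attention system *)

Section attention_dynamics.
Context {R : realType} {n l h : nat} {W : 'M[R]_(n.+1)}.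
Hypothesis Wsym : W^T = W.
Hypothesis Wpos : positive_definite W.
Variable P : 'I_h -> R -> 'M[R]_(n.+1).
Hypothesis h_gt0 : (0 < h)%N.
Hypothesis Pbounded : forall eta : 'I_h,
  has_ubound [set frobenius (P eta t) | t in `[0, +oo[ ].

(** Points of the ellipsoid have bounded coordinates and the [P eta] are bounded in time, so all
    exponents lie in a fixed interval; this makes [c0] uniform in the time and the state. *)
Lemma attention_weight_lower_bound :
  exists2 c0 : R, 0 < c0 & forall (t : R) (x : tokens R n l) i j, 0 <= t ->
    (forall k, ellipsoid W (x k)) ->
    c0 <= \sum_eta attention (P eta t) x i j.
Proof.
have [X X0 xX] := coord_ellipsoid_bounded Wsym Wpos.
have [B BP] := choice Pbounded.
pose b eta := \sum_(j < n.+1) \sum_(k < n.+1) X * B eta * X.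
pose a eta := expR (- b eta) / (Num.sqrt (n.+1)%:R * (l%:R * expR (b eta))).
have [l0|l0] := posnP l.
  by exists 1 => // t x i; have := ltn_ord i; rewrite [X in (_ < X)%N]l0.
have a0 eta : 0 < a eta.
  by rewrite divr_gt0 ?mulr_gt0 ?expR_gt0 ?sqrtr_gt0 ?ltr0n.
have [k0] : inhabited 'I_h by split; exact: Ordinal h_gt0.
exists (\sum_eta a eta).
  by rewrite (bigD1 k0)//= ltr_pwDl// sumr_ge0// => k _; exact: ltW.
move=> t x i j t0 xE; apply: ler_sum => eta _; apply: attention_lower_bound.
move=> i' j'; apply: bilinear_form_bound; first exact: ltW.
- by move=> k; exact: xX.
- by move=> k; exact: xX.
- by apply: BP; exists t => //=; rewrite in_itv/= t0.
Qed.

Variable y : R -> tokens R n l.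
Hypothesis ysol : attention_solution W P y.

Let c i j (t : R) := \sum_eta attention (P eta t) (y t) i j.
Let form (L : 'rV[R]_(n.+1)) i (t : R) : R := (L *m y t i) 0 0.

Let y_ellipsoid (t : R) i : 0 <= t -> ellipsoid W (y t i).
Proof. by have [yE _ _] := ysol; exact: yE. Qed.

Lemma solution_form_derive L i (t : R) : 0 < t ->
  is_derive t (1 : R) (form L i)
    (\sum_j c i j t * form L j t -
     form L i t * \sum_j c i j t * wdot W (y t i) (y t j)).
Proof.
move=> t0; rewrite -mulmx_attention_field; apply: is_derive_row_form.
by have [_ yd _] := ysol; exact: yd.
Qed.

(** Right continuity at 0 is recovered from the right derivative by writing [y s i] as [s] times its
    difference quotient plus [y 0 i]. *)
Lemma solution_form_cvg0 L i : form L i s @[s --> 0^'+] --> form L i 0.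
Proof.
apply: cvg_row_form; have [_ _ y0] := ysol.
have : s *: (s^-1 *: (y s i - y 0 i)) + y 0 i @[s --> (0 : R)^'+] -->
    0 *: attention_field W P 0 (y 0) i + y 0 i.
  apply: cvgD; last exact: cvg_cst.
  apply: cvgZ; last exact: y0.
  by apply: cvg_at_right_filter; exact: cvg_id.
rewrite scale0r add0r; apply: cvg_trans; apply: near_eq_cvg; near=> s.
have s0 : 0 < s by near: s; exact: nbhs_right_gt.
by rewrite scalerA divff ?gt_eqF// scale1r subrK.
Unshelve. all: by end_near. Qed.

Variable L0 : 'rV[R]_(n.+1).
Hypothesis y0_pos : forall i, 0 < form L0 i 0.

(** Here [L0] stands for [v^T]. The maximum principle is applied to the negated forms with threshold
    0, so the sign is checked only where the smallest form [f_i] is positive; there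
    [f_j >= f_i >= f_i * wdot W y_i y_j], and the derivative of [f_i] is nonnegative. *)
Lemma solution_form_lower_bound :
  exists2 m : R, 0 < m & forall i t, 0 <= t -> m <= form L0 i t.
Proof.
have [c0 c0_gt0 c0P] := attention_weight_lower_bound.
(* The default value 1 of the minimum is positive and so preserves positivity. *)
pose m := \big[Num.min/1]_i form L0 i 0.
have m0 : 0 < m by apply/bigmin_gtP; split.
exists m => // i t t0; rewrite -lerN2.
move: i t t0; apply: (@max_nonincreasing _ _ (fun i => - form L0 i)
  (fun i t => - (\sum_j c i j t * form L0 j t -
     form L0 i t * \sum_j c i j t * wdot W (y t i) (y t j))) _ 0).
- by rewrite oppr_lt0.
- by move=> i; apply: cvgN; exact: solution_form_cvg0.
- by move=> i t t0; apply: is_deriveN; exact: solution_form_derive.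
- by move=> i; rewrite lerN2; exact: bigmin_le_cond.
- move=> i t t0 /=; rewrite oppr_lt0 oppr_le0 => fi imin.
  rewrite subr_ge0 mulr_sumr ler_sum// => j _.
  have cij : 0 <= c i j t.
    rewrite (le_trans (ltW c0_gt0))// c0P ?ltW// => k.
    exact: y_ellipsoid (ltW t0).
  have := imin j; rewrite lerN2 => fij.
  rewrite mulrCA ler_wpM2l// (le_trans _ fij)// ler_piMr ?(ltW fi)//.
  by apply: (wdot_ellipsoid_le1 Wsym Wpos); apply: y_ellipsoid; exact: ltW.
Qed.

Lemma projected_solution_consensus L i j :
  (form L0 i t)^-1 * form L i t - (form L0 j t)^-1 * form L j t
    @[t --> +oo] --> 0.
Proof.
have [c0 c0_gt0 c0P] := attention_weight_lower_bound.
have [m m0 mP] := solution_form_lower_bound.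
have [C [C0 CP]] := row_form_bounded Wsym Wpos L0.
have f_le k t : 0 <= t -> form L0 k t <= C + 1.
  move=> t0; have := CP (y t k).
  rewrite /wdot y_ellipsoid// mulr1 -/(form L0 k t).
  by move: C0; nra.
have f_gt0 k t : 0 <= t -> 0 < form L0 k t.
  by move=> /(mP k); exact: lt_le_trans.
(* Each form [form L0 k t] lies between [m] and [C + 1], whence the lower bound [c0 * (m / (C + 1))]
   for these weights. *)
pose w i j t := c i j t * (form L0 j t / form L0 i t).
apply: (@linear_consensus _ _ (fun i t => (form L0 i t)^-1 * form L i t) w
  (c0 * (m / (C + 1)))).
- by rewrite mulr_gt0// divr_gt0//; lra.
- move=> i' j' t t0; have t0' := ltW t0.
  have C1 : 0 < C + 1 by lra.
  rewrite ler_pM ?(ltW c0_gt0)//.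
  + by rewrite divr_ge0 ?ltW.
  + by apply: c0P => // k; exact: y_ellipsoid.
  + rewrite ler_pM ?(ltW m0) ?mP//; first by rewrite invr_ge0 ltW.
    by rewrite lef_pV2 ?posrE ?f_gt0 ?f_le.
- move=> k; apply: cvgM; last exact: solution_form_cvg0.
  by apply: cvgV; [rewrite gt_eqF | exact: solution_form_cvg0].
- move=> k t t0.
  have fn0 k' : form L0 k' t != 0 by rewrite gt_eqF// f_gt0// ltW.
  have dL := solution_form_derive L k t t0.
  have dV := is_deriveV (fn0 k) (solution_form_derive L0 k t t0).
  apply: (is_derive_eq (is_deriveM dV dL)).
  (* The right-hand side is what the quotient rule leaves once the tangential terms of numerator and
     denominator cancel. *)
  have -> : \sum_k' w k k' t * ((form L0 k' t)^-1 * form L k' t -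
        (form L0 k t)^-1 * form L k t) =
      (form L0 k t)^-1 * \sum_k' c k k' t * form L k' t -
      form L k t / form L0 k t ^+ 2 * \sum_k' c k k' t * form L0 k' t.
    rewrite !mulr_sumr -sumrB; apply: eq_bigr => k' _; rewrite /w.
    by field; rewrite !fn0.
  by rewrite /GRing.scale/=; field; rewrite fn0.
Qed.

Lemma solution_gap_cvg0 i j :
  wdot W (y t i - y t j) (y t i - y t j) @[t --> +oo] --> 0.
Proof.
have [m m0 mP] := solution_form_lower_bound.
have f_gt0 k t : 0 <= t -> 0 < form L0 k t.
  by move=> /(mP k); exact: lt_le_trans.
have [C [C0 CP]] := row_form_bounded Wsym Wpos L0.
have f_sqr_le k t : 0 <= t -> form L0 k t ^+ 2 <= C.
  by move=> t0; have := CP (y t k); rewrite /wdot y_ellipsoid// mulr1.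
pose d t := (form L0 i t)^-1 *: y t i - (form L0 j t)^-1 *: y t j.
have dL (L : 'rV[R]_(n.+1)) : (L *m d t) 0 0 @[t --> +oo] --> 0.
  have -> : (fun t => (L *m d t) 0 0) = (fun t =>
      (form L0 i t)^-1 * form L i t - (form L0 j t)^-1 * form L j t).
    by apply/funext => t; rewrite /d mulmxBr -!scalemxAr /form !mxE.
  exact: projected_solution_consensus.
have qd : C * wdot W (d t) (d t) @[t --> +oo] --> 0.
  rewrite -(mulr0 C); apply: cvgMl_tmp.
  (* A finite sum of products of two linear forms of [d t], each of which tends to 0. *)
  have -> : (fun t => wdot W (d t) (d t)) = (fun t =>
      \sum_k (row k 1%:M *m d t) 0 0 * (row k W *m d t) 0 0).
    apply/funext => t; rewrite /wdot -mulmxA mxE; apply: eq_bigr => k _.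
    by rewrite -!row_mul mul1mx !mxE.
  apply: cvgr_sum0 => k.
  by rewrite -(mulr0 0); apply: cvgM; exact: dL.
apply: (squeeze_cvgr _ (cvg_cst 0) qd); near=> t.
have t0 : 0 <= t by near: t; apply: nbhs_pinfty_ge; exact: num_real.
rewrite (wdot_ge0 Wpos)/=.
apply: (le_trans (wdot_sub_central_projection Wsym _ _ _ _ (f_gt0 i t t0)
  (f_gt0 j t t0) (y_ellipsoid t i t0) (y_ellipsoid t j t0))).
rewrite ler_wpM2r ?(wdot_ge0 Wpos)//.
(* The product of the two forms is at most half the sum of their squares, hence at most [C]. *)
have := f_sqr_le i t t0; have := f_sqr_le j t t0.
have := sqr_ge0 (form L0 i t - form L0 j t); nra.
Unshelve. all: by end_near. Qed.

Lemma solution_dist_cvg0 j :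
  euclidean_dist (y t) (fun=> y t j) @[t --> +oo] --> 0.
Proof.
rewrite -(@sqrtr0 R); apply: continuous_cvg; first exact: sqrt_continuous.
apply: cvgr_sum0 => i.
under eq_fun do rewrite frobenius_sqr.
apply: cvgr_sum0 => k; apply: cvgr_sum0 => k'.
(* The squared coordinate is the square of a linear form, so the [W]-norm of the gap dominates
   it. *)
have [C [C0 CP]] := row_form_bounded Wsym Wpos (delta_mx 0 k).
have qy : C * wdot W (y t i - y t j) (y t i - y t j) @[t --> +oo] --> 0.
  by rewrite -(mulr0 C); apply: cvgMl_tmp; exact: solution_gap_cvg0.
apply: (squeeze_cvgr _ (cvg_cst 0) qy); near=> t.
by have := CP (y t i - y t j); rewrite sqr_ge0 -rowE [k']ord1 mxE.
Unshelve. all: by end_near. Qed.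

End attention_dynamics.

(** * From vanishing gaps to the distance from the consensus set *)

Theorem theorem4p1 (R : realType) (n l h : nat)
  (hn : (0 < n)%N) (hl : (0 < l)%N) (hh : (0 < h)%N)
  (W : 'M[R]_(n.+1)) (Wsym : W^T = W) (Wpos : positive_definite W)
  (P : 'I_h -> R -> 'M[R]_(n.+1))
  (Pbounded : forall eta : 'I_h,
     has_ubound [set frobenius (P eta t) | t in `[0, +oo[ ])
  (Punif : forall eta : 'I_h,
     unif_continuous (P eta : subspace `[0 : R, +oo[ -> 'M[R]_(n.+1)))
  (v : 'cV[R]_(n.+1)) (hv : ellipsoid W v)
  (y : R -> tokens R n l) (ysol : attention_solution W P y)
  (y0 : forall i : 'I_l, hemisphere W v (y 0 i)) :
  dist_to_set (y t) (consensus W v) @[t --> +oo] --> (0 : R).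
Proof.
have v_pos i : 0 < (v^T *m y 0 i) 0 0 by have [] := y0 i.
have [m m0 mP] :=
  solution_form_lower_bound Wsym Wpos P hh Pbounded y ysol v^T v_pos.
(* Any fixed token [j] serves as a moving reference: the diagonal point at [y t j] bounds the
   distance to the set from above. *)
have [j] : inhabited 'I_l by split; exact: Ordinal hl.
have dist_ge0 (x z : tokens R n l) : 0 <= euclidean_dist x z.
  exact: sqrtr_ge0.
have distj := solution_dist_cvg0 Wsym Wpos P hh Pbounded y ysol v^T v_pos j.
apply: (squeeze_cvgr _ (cvg_cst 0) distj); near=> t.
have t0 : 0 <= t by near: t; apply: nbhs_pinfty_ge; exact: num_real.
(* The reference stays in the open hemisphere because its form is at least [m > 0] at all times. *)
have inC : [set euclidean_dist (y t) z | z in consensus W v]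
    (euclidean_dist (y t) (fun=> y t j)).
  exists (fun=> y t j) => //; exists (y t j) => //; split.
    by have [yE _ _] := ysol; exact: yE.
  exact: lt_le_trans m0 (mP j t t0).
apply/andP; split.
  apply: lb_le_inf; first by exists (euclidean_dist (y t) (fun=> y t j)).
  by move=> _ [z _ <-].
by apply: ge_inf => //; exists 0 => _ [z _ <-].
Unshelve. all: by end_near. Qed.
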